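(* Let $\mathcal{F}$ be a dominance monotone set of graphs such that no graph in $\mathcal{F}$ has a dominating vertex. Then $\overline{\mathcal{F}}=\{\overline{F}: F\in\mathcal{F}\}$ is dominance monotone as well.
   Context: All graphs are finite and simple. A degree sequence is written as a list of nonnegative integers in nonincreasing order. For lists $d=(d_1,\dots,d_n)$ and $e=(e_1,\dots,e_p)$ of positive integers in nonincreasing order, $d$ majorizes $e$, written $d\succeq e$, if $\sum_{i=1}^n d_i=\sum_{i=1}^p e_i$ and $\sum_{i=1}^k e_i\le\sum_{i=1}^k d_i$ for $1\le k\le\min\{p,n\}$. The dominance order $\mathcal{D}_{2m}$ is the set of degree sequences of simple graphs with all terms positive and sum $2m$, ordered by $\succeq$. A realization of a degree sequence is a graph with that degree sequence. For a set $\mathcal{F}$ of graphs, a graph is $\mathcal{F}$-free if it contains no induced subgraph isomorphic to an element of $\mathcal{F}$; a degree sequence is forcibly $\mathcal{F}$-free if every realization of it is $\mathcal{F}$-free. A set $\mathcal{F}$ is dominance monotone if whenever $d,e$ are degree sequences (with positive terms) with $d\succeq e$ and $e$ forcibly $\mathcal{F}$-free, then $d$ is forcibly $\mathcal{F}$-free. A dominating vertex of a graph $G$ is a vertex of degree $|V(G)|-1$. $\overline{G}$ denotes the complement of $G$. *)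

(* Defs.v *)
From mathcomp Require Import all_boot.

Set Implicit Arguments.
Unset Strict Implicit.
Unset Printing Implicit Defensive.

Record sgraph := SGraph {
  vertex :> finType;
  adj : rel vertex;
  adj_sym : symmetric adj;
  adj_irr : irreflexive adj
}.

Arguments adj {s} x y : rename.

Definition graph_iso (G H : sgraph) : Prop :=
  exists2 f : G -> H, bijective f & forall x y, adj (f x) (f y) = adj x y.

Section Constructions.
Variable G : sgraph.

Definition compl_rel : rel G := fun x y => (x != y) && ~~ adj x y.

Lemma compl_sym : symmetric compl_rel.
Proof. by move=> x y; rewrite /compl_rel eq_sym adj_sym. Qed.

Lemma compl_irr : irreflexive compl_rel.
Proof. by move=> x; rewrite /compl_rel eqxx. Qed.

Definition compl : sgraph := SGraph compl_sym compl_irr.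

Variable S : {set G}.

Definition induced_rel : rel {x : G | x \in S} := fun x y => adj (val x) (val y).

Lemma induced_sym : symmetric induced_rel.
Proof. by move=> x y; rewrite /induced_rel adj_sym. Qed.

Lemma induced_irr : irreflexive induced_rel.
Proof. by move=> x; rewrite /induced_rel adj_irr. Qed.

Definition induced : sgraph := SGraph induced_sym induced_irr.

End Constructions.

Definition degree (G : sgraph) (v : G) : nat := #|[set w | adj v w]|.

Definition dominating (G : sgraph) (v : G) : Prop := degree v = #|G|.-1.

Definition degree_sequence (G : sgraph) : seq nat :=
  sort geq [seq degree v | v : G].

Definition realizes (G : sgraph) (d : seq nat) : Prop := degree_sequence G = d.

Definition is_degree_sequence (d : seq nat) : Prop :=
  exists G : sgraph, realizes G d.

Definition positive_terms (d : seq nat) : bool := all (fun k => 0 < k) d.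

Definition majorizes (d e : seq nat) : Prop :=
  sumn d = sumn e /\
  forall k, 1 <= k <= minn (size e) (size d) ->
    sumn (take k e) <= sumn (take k d).

(* Sets of graphs need not be closed under isomorphism: isomorphism is
   accounted for in [is_free]. *)
Definition graph_set := sgraph -> Prop.

Definition is_free (F : graph_set) (G : sgraph) : Prop :=
  forall H : sgraph, F H -> ~ exists S : {set G}, graph_iso (induced S) H.

Definition forcibly_free (F : graph_set) (d : seq nat) : Prop :=
  forall G : sgraph, realizes G d -> is_free F G.

Definition dominance_monotone (F : graph_set) : Prop :=
  forall d e : seq nat,
    is_degree_sequence d -> positive_terms d ->
    is_degree_sequence e -> positive_terms e ->
    majorizes d e -> forcibly_free F e -> forcibly_free F d.

Definition compl_set (F : graph_set) : graph_set :=
  fun G => exists2 H : sgraph, F H & G = compl H.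

(* Main.v *)
(** Complementation reverses the degree order but preserves majorization
    between sequences of equal length, provided both graphs are first padded
    with isolated vertices.  Padding [e] by exactly one zero and [d] to the
    same length makes every complementary degree positive, and the padding
    vertex, being dominating in the complement, cannot take part in an induced
    copy of a graph of [F]; hence nothing is lost on the [e] side. *)
Require Import Defs.
From mathcomp Require Import all_boot zify.

Set Implicit Arguments.
Unset Strict Implicit.
Unset Printing Implicit Defensive.

(** * Induced subgraphs as embeddings *)

Definition embeds (H G : sgraph) : Prop :=
  exists2 f : H -> G, injective f & forall x y, adj (f x) (f y) = adj x y.

(** Replaces vertex subsets and their subtypes by plain injections, which can be composed and
    carried to complements directly. *)
Lemma induced_iso_embeds (G H : sgraph) :
  (exists S : {set G}, graph_iso (induced S) H) <-> embeds H G.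
Proof.
split=> [[S [f [g fK gK] f_adj]]|[f f_inj f_adj]].
  exists (fun x => val (g x)) => [x y /val_inj/(can_inj gK) //|x y].
  by rewrite -{2}(gK x) -{2}(gK y) f_adj.
have fS x : f x \in f @: [set: H] by exact: imset_f.
pose g x : induced (f @: [set: H]) := Sub (f x) (fS x).
have [h gK hK] : bijective g.
  apply: inj_card_bij => [x y /(congr1 val)/= /f_inj //|].
  by rewrite card_sig (eq_card (B := f @: [set: H])) // card_imset // cardsT.
exists (f @: [set: H]), h => [|x y]; first by exists g.
by rewrite -{2}(hK x) -{2}(hK y) /= /induced_rel /= f_adj.
Qed.

(** The same map serves both sides: injectivity preserves distinctness, and on distinct pairs
    complementing only negates adjacency. *)
Lemma embeds_compl_iff (H G : sgraph) :
  embeds (compl H) G <-> embeds H (compl G).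
Proof.
split=> [] [f f_inj f_adj]; exists f => // x y; have:= f_adj x y => /=;
  rewrite /compl_rel (inj_eq f_inj); case: eqP => [->|_] /=;
  rewrite ?adj_irr //; by [move->; rewrite negbK | move<-; rewrite negbK].
Qed.

(** * Degree sequences and complementation *)

Lemma geq_trans : transitive geq.
Proof. by move=> b a c /= ab bc; exact: leq_trans bc ab. Qed.

Lemma geq_anti : antisymmetric geq.
Proof. by move=> a b; rewrite /= andbC => /anti_leq. Qed.

Lemma geq_total : total geq.
Proof. by move=> a b; exact: leq_total. Qed.

Lemma degree_sequence_sorted (G : sgraph) : sorted geq (degree_sequence G).
Proof. exact: (sort_sorted geq_total). Qed.

Lemma degree_sequence_eq (G : sgraph) (d : seq nat) :
  sorted geq d -> perm_eq [seq degree v | v : G] d -> degree_sequence G = d.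
Proof.
move=> d_sorted Gd; apply: (sorted_eq geq_trans geq_anti) => //.
  exact: degree_sequence_sorted.
by rewrite /degree_sequence perm_sort.
Qed.

Lemma size_degree_sequence (G : sgraph) : size (degree_sequence G) = #|G|.
Proof. by rewrite size_sort size_map -cardE. Qed.

Lemma degree_lt_card (G : sgraph) (v : G) : degree v < #|G|.
Proof.
rewrite /degree -cardsT; apply: proper_card; apply/properP; split.
  exact: subsetT.
by exists v; rewrite ?inE // adj_irr.
Qed.

Lemma degree_sequence_lt_size (G : sgraph) :
  {in degree_sequence G, forall x, x < size (degree_sequence G)}.
Proof.
move=> x; rewrite size_degree_sequence mem_sort => /mapP[v _ ->].
exact: degree_lt_card.
Qed.

Lemma degree_compl (G : sgraph) (v : G) :
  degree (v : compl G) = #|G|.-1 - degree v.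
Proof.
have -> : degree (v : compl G) = #|~: [set w | adj v w] :\ v|.
  by rewrite /degree; apply: eq_card => w; rewrite !inE /= /compl_rel eq_sym.
have := cardsC [set w | adj v w]; have := cardsD1 v (~: [set w | adj v w]).
by rewrite !inE adj_irr /= /degree; lia.
Qed.

(** Subtraction from [p] reverses the order, and [rev] restores it. For the degrees of a complement,
    [p] is the number of vertices minus one. *)
Definition compl_seq (p : nat) (s : seq nat) : seq nat :=
  rev [seq p - x | x <- s].

Lemma compl_seq_sorted (p : nat) (s : seq nat) :
  sorted geq s -> sorted geq (compl_seq p s).
Proof.
move=> s_sorted; rewrite rev_sorted sorted_map.
by apply: sub_sorted s_sorted => x y /= yx; exact: leq_sub2l.
Qed.

Lemma compl_seqK (p : nat) (s : seq nat) :
  {in s, forall x, x <= p} -> compl_seq p (compl_seq p s) = s.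
Proof.
move=> s_le; rewrite /compl_seq map_rev revK -map_comp.
by apply: map_id_in => x /s_le /subKn.
Qed.

Lemma degree_sequence_compl (G : sgraph) :
  degree_sequence (compl G) = compl_seq #|G|.-1 (degree_sequence G).
Proof.
apply: degree_sequence_eq.
  exact/compl_seq_sorted/degree_sequence_sorted.
rewrite perm_sym perm_rev perm_sym.
have -> : [seq degree v | v : compl G] =
          [seq #|G|.-1 - x | x <- [seq degree v | v : G]].
  by rewrite -map_comp; apply: eq_map => v; exact: degree_compl.
by apply: perm_map; rewrite perm_sym perm_sort.
Qed.

(** * Majorization under complementation and padding *)

Lemma sumn_compl_map (p : nat) (s : seq nat) :
  {in s, forall x, x <= p} ->
  sumn [seq p - x | x <- s] + sumn s = size s * p.
Proof.
elim: s => //= x s IH s_le.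
have /IH : {in s, forall y, y <= p} by move=> y ys; apply: s_le; rewrite inE ys orbT.
by have := s_le x (mem_head _ _); lia.
Qed.

(** The first [k] complementary terms come from the last [k] terms of [s], whose sum is the total
    minus a prefix sum. The additive form avoids truncated subtraction. *)
Lemma sumn_take_compl_seq (p k : nat) (s : seq nat) :
  {in s, forall x, x <= p} -> k <= size s ->
  sumn (take k (compl_seq p s)) + sumn s =
  k * p + sumn (take (size s - k) s).
Proof.
move=> s_le ks; rewrite take_rev sumn_rev size_map -map_drop.
have := congr1 sumn (cat_take_drop (size s - k) s); rewrite sumn_cat.
have : {in drop (size s - k) s, forall x, x <= p} by move=> x /mem_drop/s_le.
by move/sumn_compl_map; rewrite size_drop subKn //; lia.
Qed.

Lemma majorizes_take (d e : seq nat) (k : nat) :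
  majorizes d e -> k <= size e -> k <= size d ->
  sumn (take k e) <= sumn (take k d).
Proof.
move=> [_ maj]; case: k => [|k] ke kd; first by rewrite !take0.
by apply: maj; rewrite leq_min ke kd.
Qed.

(** Since totals and lengths agree, the inequality at [k] for the complements is the inequality at
    [size e - k] for the originals, in the same direction. *)
Lemma majorizes_compl_seq (p : nat) (d e : seq nat) :
  size d = size e ->
  {in d, forall x, x <= p} -> {in e, forall x, x <= p} ->
  majorizes d e -> majorizes (compl_seq p d) (compl_seq p e).
Proof.
move=> sde d_le e_le maj; split.
  have := maj.1; rewrite !sumn_rev; have := sumn_compl_map d_le.
  by have := sumn_compl_map e_le; rewrite sde; lia.
move=> k; rewrite !size_rev !size_map sde minnn => /andP[_ ke].
have kd : k <= size d by rewrite sde.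
have := sumn_take_compl_seq e_le ke; have := sumn_take_compl_seq d_le kd.
have := majorizes_take (k := size e - k) maj (leq_subr _ _).
by have := maj.1; rewrite sde => ? /(_ (leq_subr _ _)); lia.
Qed.

Lemma positive_sumn_eq0 (s : seq nat) :
  positive_terms s -> sumn s = 0 -> s = [::].
Proof. by case: s => //= x s /andP[x_gt0 _]; lia. Qed.

(** If [d] were longer, its prefix of length [size e] would already reach the common total, leaving
    positive terms with sum zero. *)
Lemma majorizes_size (d e : seq nat) :
  positive_terms d -> majorizes d e -> size d <= size e.
Proof.
move=> d_gt0 maj; case: leqP => // ed.
have := majorizes_take maj (leqnn _) (ltnW ed); rewrite take_size -maj.1.
rewrite -{1}(cat_take_drop (size e) d) sumn_cat => sum_le.
have : drop (size e) d = [::].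
  apply: positive_sumn_eq0; last by lia.
  by apply/allP => x /mem_drop; apply/allP.
by move/(congr1 size); rewrite size_drop /=; lia.
Qed.

Lemma leq_sumn_take (k : nat) (s : seq nat) : sumn (take k s) <= sumn s.
Proof. by rewrite -{2}(cat_take_drop k s) sumn_cat leq_addr. Qed.

(** Past [size d], the prefix of the padded [d] equals the common total, which bounds every prefix
    sum of the padded [e]. *)
Lemma majorizes_pad (d e : seq nat) (a b : nat) :
  size d <= size e -> majorizes d e ->
  majorizes (d ++ nseq a 0) (e ++ nseq b 0).
Proof.
move=> de maj; have pad_sum s c : sumn (s ++ nseq c 0) = sumn s.
  by rewrite sumn_cat sumn_nseq mul0n addn0.
split=> [|k _]; first by rewrite !pad_sum maj.1.
have [kd|dk] := leqP k (size d).
  by rewrite !takel_cat ?(leq_trans kd) // majorizes_take // (leq_trans kd).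
have -> : sumn (take k (d ++ nseq a 0)) = sumn d.
  rewrite take_cat ltnNge (ltnW dk) /= sumn_cat.
  rewrite (_ : sumn (take _ _) = 0) ?addn0 //.
  by apply/eqP; rewrite -leqn0 (leq_trans (leq_sumn_take _ _)) ?(pad_sum [::]).
by rewrite maj.1 -(pad_sum e b) leq_sumn_take.
Qed.

(** * Adding and removing isolated vertices *)

Section AddIsolated.
Variables (G : sgraph) (k : nat).

Definition add_isolated_rel : rel (G + 'I_k)%type :=
  fun u v => match u, v with inl x, inl y => adj x y | _, _ => false end.

Lemma add_isolated_sym : symmetric add_isolated_rel.
Proof. by move=> [x|i] [y|j] //=; rewrite adj_sym. Qed.

Lemma add_isolated_irr : irreflexive add_isolated_rel.
Proof. by move=> [x|i] //=; rewrite adj_irr. Qed.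

Definition add_isolated : sgraph := SGraph add_isolated_sym add_isolated_irr.

Lemma embeds_add_isolated (H : sgraph) : embeds H G -> embeds H add_isolated.
Proof.
by case=> f f_inj f_adj; exists (fun x => inl (f x)) => [x y [/f_inj]|].
Qed.

Lemma degree_add_isolated_inl (x : G) :
  degree (inl x : add_isolated) = degree x.
Proof.
rewrite /degree -(card_imset _ (@inl_inj G 'I_k)); apply: eq_card => -[y|i].
  by rewrite inE (mem_imset _ _ (@inl_inj _ _)) inE.
by rewrite inE; apply/esym/imsetP => -[].
Qed.

Lemma degree_add_isolated_inr (i : 'I_k) :
  degree (inr i : add_isolated) = 0.
Proof. by apply: eq_card0 => -[y|j]; rewrite inE. Qed.

Lemma degree_sequence_add_isolated :
  degree_sequence add_isolated = degree_sequence G ++ nseq k 0.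
Proof.
apply: degree_sequence_eq.
  rewrite (sorted_pairwise geq_trans) pairwise_cat.
  rewrite -!(sorted_pairwise geq_trans) degree_sequence_sorted.
  apply/and3P; split=> //; first by apply/allrelP => x y _ /nseqP[->].
  by case: (k) => //=; elim.
have enum_sum : perm_eq (enum add_isolated)
    (map inl (enum G) ++ map inr (enum 'I_k)).
  apply: uniq_perm => [||u]; first exact: enum_uniq.
    rewrite cat_uniq (map_inj_uniq (@inl_inj _ _)) (map_inj_uniq (@inr_inj _ _)).
    rewrite !enum_uniq andbT; apply/hasPn => _ /mapP[i _ ->]; by apply/mapP => -[].
  rewrite mem_enum mem_cat; apply/esym/orP.
  by case: u => [x|i]; [left | right]; apply/map_f; rewrite mem_enum.
apply: perm_trans (perm_map _ enum_sum) _; rewrite map_cat -!map_comp.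
rewrite (eq_map degree_add_isolated_inl) (eq_map degree_add_isolated_inr) -!enumT.
have -> : [seq 0 | _ <- enum 'I_k] = nseq k 0.
  by rewrite -[in RHS](size_enum_ord k); elim: (enum _) => //= ? ? ->.
by rewrite perm_cat2r perm_sym perm_sort.
Qed.

End AddIsolated.

Lemma degree_induced_isolated (G : sgraph) (v : G) (x : induced [set~ v]) :
  degree v = 0 -> degree x = degree (val x).
Proof.
move=> /cards0_eq v0; rewrite /degree -(card_imset _ val_inj).
apply: eq_card => y; rewrite inE; apply/imsetP/idP => [[z]|xy].
  by rewrite inE => xz ->.
have yv : y \in [set~ v].
  rewrite !inE; apply: contraTneq xy => ->.
  by have := in_set0 (val x); rewrite -v0 inE adj_sym => ->.
by exists (Sub y yv); rewrite ?inE.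
Qed.

Lemma degree_sequence_remove_isolated (G : sgraph) (v : G) (e : seq nat) :
  degree v = 0 -> realizes G (e ++ [:: 0]) -> sorted geq e ->
  realizes (induced [set~ v]) e.
Proof.
move=> v0 Ge e_sorted; apply: degree_sequence_eq => //.
(* The zero of the deleted vertex is put back on both sides, then read as [degree v], so that only
   two enumerations of the vertices of [G] remain to be compared. *)
rewrite -(perm_cat2r [:: 0]) -Ge perm_sym perm_sort perm_sym.
have -> : [seq degree x | x : induced [set~ v]] =
          [seq degree x | x <- map val (enum (induced [set~ v]))].
  by rewrite -map_comp; apply: eq_map => x; exact: degree_induced_isolated.
rewrite -v0 -[[:: degree v]]/(map (@degree G) [:: v]) -map_cat.
apply: perm_map; apply: uniq_perm => [||x].
- rewrite cat_uniq (map_inj_uniq val_inj) enum_uniq /= orbF andbT.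
  by apply/mapP => -[[y yv] _ /= vy]; move: yv; rewrite -vy !inE eqxx.
- exact: enum_uniq.
rewrite mem_cat mem_enum !inE; apply/orP; case: (eqVneq x v) => [|xv]; first by right.
left; have xS : x \in [set~ v] by rewrite !inE.
by apply/mapP; exists (Sub x xS); rewrite ?mem_enum.
Qed.

(** * Dominating vertices and forcible freeness of complements *)

Lemma embedding_degree_lt (H K : sgraph) (f : H -> K) (x : H) :
  injective f -> (forall y z, adj (f y) (f z) = adj y z) ->
  degree (f x) = #|K|.-1 -> dominating x.
Proof.
move=> f_inj f_adj fx_dom.
(* By counting, [f x] is adjacent to every vertex but itself; pulling this back along [f] makes [x]
   dominating. *)
have /eqP adj_all : [set w | adj (f x) w] == [set~ f x].
  rewrite eqEcard -/(degree (f x)) fx_dom cardsC1 leqnn andbT.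
  apply/subsetP => w; rewrite !inE; apply: contraTneq => ->.
  by rewrite adj_irr.
rewrite /dominating /degree -(cardsC1 x); apply: eq_card => y.
have : (f y \in [set w | adj (f x) w]) = (f y != f x) by rewrite adj_all !inE.
by rewrite !inE f_adj (inj_eq f_inj).
Qed.

(** A realization [K] is not given as a padded graph, so the padding vertex is recovered from its
    degree: the appended zero yields an isolated vertex of [compl K]. Deleting it leaves a
    realization of [e]. *)
Lemma forcibly_free_compl_seq (F : graph_set) (e : seq nat) :
  (forall H : sgraph, F H -> ~ exists v : H, dominating v) ->
  is_degree_sequence e -> forcibly_free (compl_set F) e ->
  forcibly_free F (compl_seq (size e) (e ++ [:: 0])).
Proof.
move=> F_nodom [E Ee] e_free K Ke H FH /induced_iso_embeds[f f_inj f_adj].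
have e_le : {in e ++ [:: 0], forall x, x <= size e}.
  move=> x; rewrite mem_cat => /orP[|]; last by rewrite inE => /eqP->.
  by rewrite -Ee => /degree_sequence_lt_size/ltnW.
have cardK : #|K| = (size e).+1.
  by rewrite -size_degree_sequence Ke size_rev size_map size_cat addn1.
have CKe : realizes (compl K) (e ++ [:: 0]).
  by rewrite /realizes degree_sequence_compl Ke cardK compl_seqK.
have [v v0] : exists v : compl K, degree v = 0.
  have : 0 \in degree_sequence (compl K) by rewrite CKe mem_cat mem_head orbT.
  by rewrite mem_sort => /mapP[v _ ->]; exists v.
have v_dom : degree (v : K) = #|K|.-1.
  have := degree_compl (v : K); rewrite v0.
  by have := degree_lt_card (v : K); lia.
(* Otherwise the copy of [H] would use the dominating vertex [v] of [K], and [H] would have a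
   dominating vertex itself. *)
have fv x : f x \in [set~ v].
  rewrite !inE; apply/eqP => fx; apply: (F_nodom H FH); exists x.
  by apply: (embedding_degree_lt f_inj f_adj); rewrite fx.
have e_sorted : sorted geq e by rewrite -Ee degree_sequence_sorted.
apply: (e_free _ (degree_sequence_remove_isolated v0 CKe e_sorted) (compl H)).
  by exists H.
apply/induced_iso_embeds.
exists (fun x => Sub (f x) (fv x)) => [x y /(congr1 val)/= /f_inj //|x y].
by rewrite /= /induced_rel /= /compl_rel (inj_eq f_inj) f_adj.
Qed.

Lemma realizes_compl_add_isolated (G : sgraph) (d : seq nat) (k p : nat) :
  realizes G d -> size d + k = p.+1 ->
  realizes (compl (add_isolated G k)) (compl_seq p (d ++ nseq k 0)).
Proof.
move=> Gd dk; rewrite /realizes degree_sequence_compl.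
rewrite -size_degree_sequence degree_sequence_add_isolated Gd.
by rewrite size_cat size_nseq dk.
Qed.

Theorem theorem3p1 (F : graph_set)
    (F_monotone : dominance_monotone F)
    (F_no_dominating : forall H : sgraph, F H -> ~ exists v : H, dominating v) :
  dominance_monotone (compl_set F).
Proof.
move=> d e d_deg d_gt0 e_deg e_gt0 maj e_free.
have de := majorizes_size d_gt0 maj.
(* The empty sequence is treated apart: padding it with one zero gives a single vertex, whose
   complementary degree is still zero. *)
have [e0|p_gt0] := posnP (size e).
  suff -> : d = e by [].
  by rewrite (size0nil e0); apply: size0nil; lia.
set p := size e in de p_gt0 *.
move=> G Gd _ [H FH ->] /induced_iso_embeds HG.
(* This many zeros bring [d] to length [p.+1], the length of [e] with one zero. *)
pose k := p.+1 - size d.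
have dk : size d + k = p.+1 by rewrite subnKC // ltnW.
have [E Ee] := e_deg.
(* The bound is strict because the unpadded graph has at most [p] vertices and [p] is positive;
   strictness makes every [p - x] positive. *)
have pad_lt s c : is_degree_sequence s -> size s <= p ->
    {in s ++ nseq c 0, forall x, x < p}.
  move=> [K <-] Kp x; rewrite mem_cat => /orP[/degree_sequence_lt_size xK|].
    exact: leq_trans xK Kp.
  by move=> /nseqP[->].
have compl_gt0 s : {in s, forall x, x < p} -> positive_terms (compl_seq p s).
  move=> s_lt; rewrite /positive_terms all_rev all_map.
  by apply/allP => x /s_lt /=; rewrite subn_gt0.
have d_lt := pad_lt d k d_deg de; have e_lt := pad_lt e 1 e_deg (leqnn _).
have GK := realizes_compl_add_isolated Gd dk.
have EK := realizes_compl_add_isolated (k := 1) Ee (addn1 _).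
have maj' : majorizes (compl_seq p (d ++ nseq k 0)) (compl_seq p (e ++ nseq 1 0)).
  apply: majorizes_compl_seq => [|x /d_lt/ltnW //|x /e_lt/ltnW //|].
    by rewrite !size_cat !size_nseq dk addn1.
  exact: majorizes_pad.
have d_free : forcibly_free F (compl_seq p (d ++ nseq k 0)).
  apply: F_monotone (compl_gt0 _ d_lt) _ (compl_gt0 _ e_lt) maj' _.
  - by eexists; exact: GK.
  - by eexists; exact: EK.
  exact: forcibly_free_compl_seq.
(* A copy of [compl H] in [G] survives the padding, and its complement is a copy of [H] in a
   realization of the complementary sequence. *)
apply: (d_free _ GK H FH).
by apply/induced_iso_embeds/embeds_compl_iff/embeds_add_isolated.
Qed.
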